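(* For every fixed integer $d\ge 3$, a random graph $G\in\mathcal{G}_{n,d}$ is asymptotically almost surely normal; that is, the probability that $G$ is normal tends to $1$ as $n\to\infty$ (over $n$ with $dn$ even).
   Context: $\mathcal{G}_{n,d}$ denotes the uniform probability space of all simple $d$-regular graphs on the vertex set $\{1,\dots,n\}$, where $dn$ is even. A graph $G$ is normal if there exist a set $\mathcal C$ of cliques of $G$ and a set $\mathcal I$ of stable (independent) sets of $G$ such that (1) every vertex of $G$ lies in some clique of $\mathcal C$; (2) every vertex of $G$ lies in some stable set of $\mathcal I$; (3) every clique in $\mathcal C$ and every stable set in $\mathcal I$ have a vertex in common. *)

(* Defs.v *)
From mathcomp Require Import all_boot all_algebra.

Set Implicit Arguments.
Unset Strict Implicit.
Unset Printing Implicit Defensive.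

Local Open Scope nat_scope.

(* A graph on a finite vertex type is given by its edge set, a set of vertex
   sets; it is simple when every edge has exactly two elements. *)
Section Graphs.

Variable V : finType.
Implicit Types (E : {set {set V}}) (K S : {set V}).

Definition simple_graph E : bool := [forall e in E, #|e| == 2].

Definition adj E (u v : V) : bool := (u != v) && ([set u; v] \in E).

Definition degree E (v : V) : nat := #|[set u | adj E v u]|.

Definition regular (d : nat) E : bool := [forall v, degree E v == d].

Definition clique E K : bool :=
  [forall u in K, forall v in K, (u != v) ==> adj E u v].

Definition stable E S : bool :=
  [forall u in S, forall v in S, ~~ adj E u v].

Definition normal_graph E : bool :=
  [exists C : {set {set V}}, exists I : {set {set V}},
    [&& [forall K in C, clique E K],
        [forall S in I, stable E S],
        [forall v, exists K in C, v \in K],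
        [forall v, exists S in I, v \in S]
      & [forall K in C, forall S in I, K :&: S != set0]]].

End Graphs.

(* The vertex set {1, ..., n} is represented by 'I_n = {0, ..., n-1}. *)
Definition regular_graphs (n d : nat) : {set {set {set 'I_n}}} :=
  [set E | simple_graph E & regular d E].

(* Probability of the event P under the uniform distribution on A; the value
   is 0 when A is empty. *)
Definition uniform_prob (R : fieldType) (T : finType) (A : {set T})
    (P : pred T) : R :=
  (#|[set x in A | P x]|%:R / #|A|%:R)%R.

Definition prob_normal (R : fieldType) (d n : nat) : R :=
  uniform_prob R (regular_graphs n d) (@normal_graph 'I_n).

(* Main.v *)
(** Let [I] be a maximal stable set, [N] its complement, and colour the vertices
    with [d^4 + 1] colours so that two vertices joined by a walk of length four
    get distinct colours.  Give [q] in [N] the least colour of its neighbours in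
    [I] as level, and [c] in [I] the greatest level of its neighbours.  Every
    vertex has a neighbour of its own level across the cut [(I, N)]; these edges
    are the cliques of the cover.  A vertex [v] of [N] is put into a stable set
    by exchanging, starting from [I], only the vertices that are forced: each
    exchanged [q] in [N] expels its neighbours in [I], and each expelled [c]
    brings in its neighbours of equal level.  Levels never decrease along this
    process and all vertices of [N] exchanged within one level share a
    neighbour, so everything exchanged lies within bounded distance of [v]
    along the cut.  Two exchanged vertices of [N] can therefore be adjacent only
    if there is a short cycle which meets [I].

    If no small vertex set spans more edges than it has vertices, each vertex on
    a short cycle has a neighbour that lies on no short cycle, and these
    neighbours can be chosen to form a stable set; extending it to [I] makes [I]
    miss all short cycles.  Finally, replacing edges [xy], [ab] by [xa], [yb]
    shows that [k + 1] given edges are present with probability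
    [O(n^-(k+1))], so by the union bound small sets of excess one
    exist with probability [O(1/n)]. *)
Require Import Defs.
From mathcomp Require Import all_boot all_order all_algebra.
From mathcomp Require Import zify.

Set Implicit Arguments.
Unset Strict Implicit.
Unset Printing Implicit Defensive.

(** * Union bound for cardinalities and greedy colouring *)

Lemma card_bigcup_leq (T I : finType) (P : pred I) (A : I -> {set T}) :
  #|\bigcup_(i | P i) A i| <= \sum_(i | P i) #|A i|.
Proof.
elim/big_rec2: _ => [|i k B _ IH]; first by rewrite cards0.
by apply: leq_trans (leq_card_setU _ _) _; rewrite leq_add2l.
Qed.

(** Colour one vertex at a time: its neighbours block at most [D] of the [D.+1] colours. The guard
    [x != y] allows [e] to hold on the diagonal, as closed walks of length four make it do. *)
Lemma bounded_degree_coloring (T : finType) (e : rel T) (D : nat) :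
  symmetric e -> (forall x, #|[set y | e x y]| <= D) ->
  exists col : T -> 'I_D.+1,
    forall x y, x != y -> e x y -> col x != col y.
Proof.
move=> e_sym e_deg.
suff [col colP] : exists col : T -> 'I_D.+1, forall x y,
    x \in enum T -> y \in enum T -> x != y -> e x y -> col x != col y.
  by exists col => x y; apply: colP; rewrite mem_enum.
elim: (enum T) => [|z s [col colP]]; first by exists (fun=> ord0).
have [a a_free] : exists a, a \notin [set col y | y in [set y | e z y]].
  apply/existsP; rewrite -negb_forall; apply/negP => /forallP all_used.
  suff : #|'I_D.+1| <= D by rewrite card_ord ltnn.
  apply: leq_trans (e_deg z); apply: leq_trans (leq_imset_card col _).
  by apply/subset_leq_card/subsetP => a _; exact: all_used.
exists (fun y => if y == z then a else col y) => x y; rewrite !inE.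
case: (eqVneq x z) => [-> | xz] /=; case: (eqVneq y z) => [-> | yz] //=.
- move=> _ ys _ ezy; apply: contraNneq a_free => ->.
  by apply: imset_f; rewrite inE.
- move=> xs _ _; rewrite e_sym => ezx; apply: contraNneq a_free => <-.
  by apply: imset_f; rewrite inE.
- exact: colP.
Qed.

(** * Normality from levels across the cut of a maximal stable set *)

Section Deterministic.

Variables (V : finType) (E : {set {set V}}).
Implicit Types (I S U W : {set V}).

Lemma adj_sym : symmetric (adj E).
Proof. by move=> x y; rewrite /adj eq_sym setUC. Qed.

Lemma adj_irr x : adj E x x = false.
Proof. by rewrite /adj eqxx. Qed.

Lemma stableP S :
  reflect {in S &, forall x y, ~~ adj E x y} (stable E S).
Proof.
apply: (iffP forall_inP) => [stS x y xS yS | stS x xS].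
  by move/forall_inP: (stS x xS) => /(_ y yS).
by apply/forall_inP => y; apply: stS.
Qed.

Definition crossing I (x y : V) :=
  adj E x y && ((x \in I) != (y \in I)).

Lemma crossing_sym I : symmetric (crossing I).
Proof. by move=> x y; rewrite /crossing adj_sym [_ == (y \in I)]eq_sym. Qed.

Section Levels.

Variables (I : {set V}) (K : nat) (col : V -> nat).

Hypothesis I_stable : stable E I.
Hypothesis I_dom : forall q, q \notin I -> exists2 c, c \in I & adj E q c.
Hypothesis I_nbr : forall c, c \in I -> exists q, adj E c q.
Hypothesis col_le : forall x, col x <= K.
(** Length four fits the walk [c, q, x, z, b] in [flow_short]: [q] and [z] share the neighbour [x],
    while [c] and [b] set their levels. *)
Hypothesis col_inj : forall c q s r c', adj E c q -> adj E q s ->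
  adj E s r -> adj E r c' -> col c = col c' -> c = c'.
(* Excludes the only possible conflict: two adjacent vertices
   outside [I] that are forced by the same vertex. *)
Hypothesis no_odd_cycle : forall q r p, q \notin I -> r \notin I ->
  adj E q r -> path (crossing I) q p -> last q p = r -> size p <= 8 * K + 4 ->
  False.

(* Levels are reversed colours, so that the truncated subtraction turns the
   maximum into a minimum. *)
Let low q := K - \max_(c in [set c in I | adj E q c]) col c.
Let lev x := if x \in I then \max_(q in [set q | adj E x q]) low q else low x.

Let nbr_notin c q : c \in I -> adj E c q -> q \notin I.
Proof. by move=> cI cq; apply: contraL cq => qI; exact: (stableP _ I_stable). Qed.

Let lev_attained q : q \notin I ->
  exists c, [/\ c \in I, adj E q c & lev q = K - col c].
Proof.
move=> qI; rewrite /lev (negPf qI) /low.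
have [c cI qc] := I_dom qI.
have /(eq_bigmax_cond col) [] : 0 < #|[set c in I | adj E q c]|.
  by apply/card_gt0P; exists c; rewrite inE cI.
by move=> b; rewrite inE => /andP[bI qb] ->; exists b.
Qed.

Let lev_le_col q c : q \notin I -> c \in I -> adj E q c -> lev q <= K - col c.
Proof.
move=> qI cI qc; rewrite /lev (negPf qI) /low leq_sub2l //.
by apply: (@leq_bigmax_cond _ _ col); rewrite inE cI.
Qed.

Let lev_le q c : c \in I -> adj E c q -> lev q <= lev c.
Proof.
move=> cI cq; rewrite /lev cI (negPf (nbr_notin cI cq)).
by apply: (@leq_bigmax_cond _ _ low); rewrite inE.
Qed.

Let lev_leK x : lev x <= K.
Proof.
rewrite /lev; case: ifP => _; last exact: leq_subr.
by apply/bigmax_leqP => q _; exact: leq_subr.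
Qed.

(** For [x] outside [I], take the neighbour [c] that sets its level: every neighbour of [c] has
    level at most [K - col c], so the maximum defining [lev c] is [lev x] itself. *)
Let lev_match x : exists y, [/\ adj E x y, (x \in I) != (y \in I)
                              & lev x = lev y].
Proof.
have [xI | xI] := boolP (x \in I).
  have [q0 xq0] := I_nbr xI.
  have /(eq_bigmax_cond low) [q] : 0 < #|[set q | adj E x q]|.
    by apply/card_gt0P; exists q0; rewrite inE.
  rewrite inE => xq lev_x; exists q; have qI := nbr_notin xI xq.
  by rewrite xq (negPf qI); split=> //; rewrite {1}/lev xI lev_x /lev (negPf qI).
have [c [cI xc lev_x]] := lev_attained xI.
exists c; rewrite cI; split=> //; apply/eqP.
rewrite eqn_leq lev_le 1?adj_sym //= {1}/lev cI lev_x.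
apply/bigmax_leqP => q; rewrite inE => cq; have qI := nbr_notin cI cq.
by have := lev_le_col qI cI; rewrite adj_sym /lev (negPf qI); apply.
Qed.

(** Exchanging [x] forces exchanging [y]: for [x] outside [I] to stay stable, for [x] in [I] to keep
    meeting the clique on [x] and [y]. *)
Let flow (x y : V) := adj E x y &&
  if x \in I then (y \notin I) && (lev x == lev y) else y \in I.

(* Along a flow walk the level never decreases, and the vertices outside I
   visited at a given level all have the same neighbour of that colour, so a
   walk can be short-cut to at most four steps per level. *)
Let flow_short v y : v \notin I -> connect flow v y ->
  exists q c p, [/\ y = q \/ y \in I /\ adj E q y, q \notin I,
    c \in I /\ adj E q c, lev q = K - col c
    & [/\ path (crossing I) v p, last v p = c & size p <= 4 * lev q + 1]].
Proof.
move=> vI /connectP[s + ->]; elim/last_ind: s => [|s z IHs] /=.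
  move=> _; have [c [cI vc lev_v]] := lev_attained vI.
  exists v, c, [:: c]; split=> //=; first by left.
  by rewrite /crossing vc cI (negPf vI) /= addn1.
rewrite rcons_path last_rcons => /andP[/IHs[q [c [p]]]].
set x := last v s => -[xq qI [cI qc] lev_q [pth lst sz]] /andP[xz].
case: ifP => xI.
  case/andP=> zI /eqP lev_xz.
  case: xq => [xq | [_ qx]]; first by rewrite -xq xI in qI.
  have lev_qz : lev q <= lev z by rewrite -lev_xz lev_le // adj_sym.
  have [b [bI zb lev_z]] := lev_attained zI.
  (* A strict rise of the level pays for the four new steps [q], [x], [z], [b]. *)
  case: (ltngtP (lev q) (lev z)) lev_qz => // lev_qz _.
    exists z, b, (p ++ [:: q; x; z; b]); split=> //; first by left.
    rewrite cat_path last_cat lst size_cat pth /= /crossing (adj_sym c q) qc qx xz zb.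
    rewrite cI (negPf qI) xI (negPf zI) bI; split=> //.
    by move: sz lev_qz; move: (lev q) (lev z) (size p) => l l' k; clear; lia.
  (* At equal level the colours agree, [col_le] undoing the truncated subtraction, so the old walk
     already ends at a neighbour of [z]. *)
  have cb : c = b.
    apply: col_inj qx xz zb _; first by rewrite adj_sym.
    move: lev_qz (col_le c) (col_le b); rewrite lev_q lev_z.
    by move: (col c) (col b) => k k'; clear; lia.
  exists z, c, p; rewrite cb -lev_z -lev_qz -cb.
  by split=> //; [left | rewrite cb].
move=> zI; case: xq => [xq | [xI']]; last by rewrite xI' in xI.
by exists q, c, p; split=> //; right; rewrite -xq.
Qed.

(** Reversing the short cut walk from [v] to [q] and appending the one to [r] gives a cut walk of
    length at most [2 * (4 * K + 2)], which the edge between [q] and [r] would close. *)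
Let no_flow_adj v q r : v \notin I -> q \notin I -> r \notin I ->
  connect flow v q -> connect flow v r -> ~~ adj E q r.
Proof.
move=> vI qI rI vq vr; apply/negP => qr.
have short x : x \notin I -> connect flow v x ->
    exists2 p, path (crossing I) v p /\ last v p = x & size p <= 4 * K + 2.
  move=> xI /(flow_short vI)[q' [c [p [xq _ [cI qc] _ [pth lst sz]]]]].
  case: xq => [xq | [xI']]; last by rewrite xI' in xI.
  (* The walk ends at the neighbour [c] of [x]; one more step reaches [x]. *)
  exists (rcons p x); last first.
    rewrite size_rcons; move: sz (lev_leK q').
    by move: (lev q') (size p) => a k; clear; lia.
  by rewrite rcons_path last_rcons pth lst /= /crossing adj_sym xq qc cI -xq (negPf xI).
have [[p [pq lq] sp] [p' [pr lr] sp']] := (short q qI vq, short r rI vr).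
apply: (no_odd_cycle (p := rev (belast v p) ++ p') qI rI qr).
- rewrite cat_path -{1}lq rev_path.
  rewrite (@eq_path _ _ (crossing I)) => [|x y]; last exact: crossing_sym.
  rewrite pq /=.
  suff -> : last q (rev (belast v p)) = v by [].
  case: p lq {pq sp} => [|a p] /= lq; first by rewrite lq.
  by rewrite rev_cons last_rcons.
- rewrite last_cat; suff -> : last q (rev (belast v p)) = v by [].
  case: p lq {pq sp} => [|a p] /= lq; first by rewrite lq.
  by rewrite rev_cons last_rcons.
- rewrite size_cat size_rev size_belast; move: sp sp'.
  by move: (size p) (size p') => a b; clear; lia.
Qed.

Lemma normal_of_levels : normal_graph E.
Proof.
pose C := [set D : {set V} | [exists x, exists y,
  [&& D == [set x; y], adj E x y, (x \in I) != (y \in I) & lev x == lev y]]].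
(* Exactly the vertices reached from [v] by [flow] change sides. *)
pose flip v := [set x | if x \in I then ~~ connect flow v x else connect flow v x].
pose J := I |: [set flip v | v in ~: I].
have CP D : D \in C -> exists c q, [/\ D = [set c; q], adj E c q,
    c \in I, q \notin I & lev c = lev q].
  rewrite inE => /existsP[x /existsP[y /and4P[/eqP -> xy xyI /eqP lev_xy]]].
  move: xyI; have [xI | xI] := boolP (x \in I); have [yI | yI] //= := boolP (y \in I).
    by exists x, y.
  by exists y, x; rewrite setUC adj_sym.
apply/existsP; exists C; apply/existsP; exists J; apply/and5P; split.
- apply/forall_inP => D /CP[c [q [-> cq _ _ _]]].
  apply/forall_inP => x; rewrite !inE => /orP[]/eqP->;
  by apply/forall_inP => y; rewrite !inE => /orP[]/eqP->;
     rewrite ?eqxx // ?cq ?implybT // adj_sym cq implybT.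
- apply/forall_inP => S; rewrite !inE => /orP[/eqP -> // | /imsetP[v]].
  rewrite inE => vI ->; apply/stableP => x y; rewrite !inE.
  have flowI q s : q \notin I -> s \in I -> adj E q s ->
      connect flow v q -> connect flow v s.
    move=> qI sI qs vq; apply: connect_trans vq _; apply: connect1.
    by rewrite /flow qs (negPf qI).
  have [xI | xI] := boolP (x \in I); have [yI | yI] := boolP (y \in I).
  + by move=> _ _; apply: (stableP _ I_stable).
  + move=> vx vy; apply: contra vx => xy.
    by apply: flowI yI xI _ vy; rewrite adj_sym.
  + by move=> vx; apply: contra => xy; apply: flowI xI yI xy vx.
  + by move=> vx vy; apply: no_flow_adj vx vy.
- apply/forallP => x; have [y [xy xyI lev_xy]] := lev_match x.
  apply/exists_inP; exists [set x; y]; last by rewrite !inE eqxx.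
  by rewrite inE; apply/existsP; exists x; apply/existsP; exists y;
     rewrite eqxx xy xyI lev_xy eqxx.
- apply/forallP => x; apply/exists_inP; have [xI | xI] := boolP (x \in I).
    by exists I; rewrite // !inE eqxx.
  exists (flip x); last by rewrite inE (negPf xI) connect0.
  by rewrite !inE; apply/orP; right; apply: imset_f; rewrite inE.
- apply/forall_inP => D /CP[c [q [-> cq cI qI lev_cq]]].
  apply/forall_inP => S; rewrite !inE => /orP[/eqP -> | /imsetP[v]].
    by apply/set0Pn; exists c; rewrite !inE eqxx cI.
  (* Either [c] stayed, or its expulsion brought in its partner [q] of equal level. *)
  move=> _ ->; apply/set0Pn; have [vc | vc] := boolP (connect flow v c).
    exists q; rewrite !inE eqxx orbT (negPf qI) /=.
    apply: connect_trans vc _; apply: connect1.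
    by rewrite /flow cq cI qI lev_cq eqxx.
  by exists c; rewrite !inE eqxx cI (negPf vc).
Qed.

End Levels.

(** * Sparse graphs and a stable set that avoids all short cycles *)

(* Stands for short cycles: in a sparse graph the vertices of such a small set
   have exactly two neighbours in it. *)
Definition two_core U :=
  [forall v in U, 1 < #|[set u in U | adj E v u]|].

(** For simple graphs: no connected subgraph on at most [M] vertices has more than one cycle. *)
Definition sparse M :=
  [forall W : {set V}, (#|W| <= M) ==> (#|[set e in E | e \subset W]| <= #|W|)].

Lemma card_gt2_mem (T : finType) (A : {set T}) a b c :
  a \in A -> b \in A -> c \in A -> a != b -> a != c -> b != c -> 2 < #|A|.
Proof.
move=> aA bA cA ab ac bc.
have -> : 3 = #|[set a; b; c]|.
  by rewrite setUC cardsU1 !inE negb_or eq_sym ac eq_sym bc cards2 ab.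
by apply/subset_leq_card/subsetP => x; rewrite !inE => /orP[/orP[]|] /eqP->.
Qed.

(** Double counting of incidences between vertices of [W] and edges inside [W]. *)
Lemma sum_inner_degree W : simple_graph E ->
  \sum_(v in W) #|[set u in W | adj E v u]| <=
    2 * #|[set e in E | e \subset W]|.
Proof.
move=> E_simple; set EW := [set e in E | e \subset W].
have inner v : v \in W ->
    #|[set u in W | adj E v u]| <= \sum_(e in EW) (v \in e).
  move=> vW; rewrite -big_mkcondr sum1dep_card.
  rewrite -(@card_in_imset _ _ (fun u => [set v; u])) => [|x y]; last first.
    rewrite !inE => /andP[_ /andP[vx _]] /andP[_ /andP[vy _]] /setP/(_ x).
    by rewrite !inE eqxx orbT eq_sym (negPf vx) => /esym/eqP.
  apply/subset_leq_card/subsetP => _ /imsetP[u + ->].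
  rewrite !inE => /andP[uW /andP[_ ->]]; rewrite eqxx !andbT /=.
  by apply/subsetP => x; rewrite !inE => /orP[]/eqP->.
apply: leq_trans (leq_sum _ inner) _; rewrite exchange_big /= mulnC -sum_nat_const.
apply: leq_sum => e; rewrite inE => /andP[eE _].
rewrite -big_mkcondr sum1dep_card -(eqP (forall_inP E_simple e eE)).
by apply/subset_leq_card/subsetP => x; rewrite inE => /andP[].
Qed.

(** Inner degrees are at least two and sum to at most twice [#|W|], so none exceeds two. *)
Lemma sparse_inner_degree M W v : simple_graph E -> sparse M -> #|W| <= M ->
  (forall x, x \in W -> 1 < #|[set u in W | adj E x u]|) ->
  v \in W -> #|[set u in W | adj E v u]| <= 2.
Proof.
move=> E_simple /forallP/(_ W)/implyP sp WM W_core vW.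
rewrite leqNgt; apply/negP => v3.
have := leq_trans (sum_inner_degree W E_simple) (leq_mul (leqnn 2) (sp WM)).
apply/negP; rewrite -ltnNge (bigD1 v) //= (cardsD1 v) vW.
have : \sum_(x in W | x != v) 2 <= \sum_(x in W | x != v) #|[set u in W | adj E x u]|.
  by apply: leq_sum => x /andP[xW _]; apply: W_core.
rewrite sum_nat_cond_const.
have -> : #|[set x in W | x != v]| = #|W :\ v|.
  by apply: eq_card => x; rewrite !inE andbC.
by move: v3; clear; lia.
Qed.

Lemma uniq_cycle_core (c : seq V) :
  uniq c -> cycle (adj E) c -> 2 < size c -> two_core [set x in c].
Proof.
move=> uc cc sc; apply/forall_inP => x; rewrite inE => xc.
have [i s rc] := rot_to xc.
have {uc} : uniq (x :: s) by rewrite -rc rot_uniq.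
have {cc} : cycle (adj E) (x :: s) by rewrite -rc rot_cycle.
have {sc} : 2 < size (x :: s) by rewrite -rc size_rot.
have mem_c y : (y \in c) = (y \in x :: s) by rewrite -rc mem_rot.
case: s rc mem_c => [|y [|z s]] //= _ mem_c _.
rewrite rcons_path => /andP[xy /andP[_ /andP[_ lx]]] /andP[_ /andP[ys _]].
rewrite (cardsD1 y) !inE mem_c !inE eqxx orbT xy /= ltnS card_gt0.
apply/set0Pn; exists (last z s); rewrite !inE mem_c adj_sym lx andbT.
rewrite 2!inE mem_last !orbT andbT.
by apply: contraNneq ys => <-; exact: mem_last.
Qed.

(** Shortened to a path and closed by the edge from [r] to [q], the walk becomes a cycle. Its second
    vertex lies in [I], so it differs from [r] and the cycle has at least three vertices. *)
Lemma crossing_odd_cycle I q r p : q \notin I -> r \notin I -> adj E q r ->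
  path (crossing I) q p -> last q p = r ->
  exists U : {set V}, [/\ two_core U, #|U| <= (size p).+1
                        & exists2 c, c \in U & c \in I].
Proof.
move=> qI rI qr; case/shortenP => p' qp' up' sub lq'.
have sub_crossing : subrel (crossing I) (adj E) by move=> x y /andP[].
exists [set x in q :: p']; split.
- apply: uniq_cycle_core => //.
    by rewrite /= rcons_path (sub_path sub_crossing qp') lq' adj_sym.
  case: p' qp' lq' {up' sub} => [_ qE|a [|b s]] //=.
    by move: qr; rewrite -qE adj_irr.
  by rewrite andbT => /[swap] -> /andP[_]; rewrite (negPf qI) (negPf rI).
- rewrite cardsE; apply: leq_trans (card_size _) _; rewrite ltnS.
  by apply: uniq_leq_size => //; case/andP: up'.
- case: p' qp' lq' {up' sub} => [_ qE|a s /= /andP[/andP[_ qa] _] _].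
    by move: qr; rewrite -qE adj_irr.
  exists a; first by rewrite !inE eqxx orbT.
  by move: qa; rewrite (negPf qI); case: (a \in I).
Qed.

(** If every vertex of a small core has a neighbour in the stable set [I0], no stable set containing
    [I0] meets a core; a maximal one also dominates. *)
Lemma stable_avoiding_cores M m : simple_graph E -> sparse M ->
  2 * m + 2 <= M -> (forall v, 2 < degree E v) ->
  exists I : {set V}, [/\ stable E I,
    forall q, q \notin I -> exists2 c, c \in I & adj E q c &
    forall U, two_core U -> #|U| <= m -> [disjoint U & I]].
Proof.
move=> E_simple E_sparse mM deg3.
pose core U := two_core U && (#|U| <= m).
pose Z := \bigcup_(U | core U) U.
(* Two cores and two extra vertices number at most [2 * m + 2], within reach of sparsity. *)
have coreU (U U' X : {set V}) x : core U -> core U' -> #|X| <= 2 ->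
    (forall y, y \in X -> 1 < #|[set u in U :|: U' :|: X | adj E y u]|) ->
    x \in U :|: U' :|: X ->
    #|[set u in U :|: U' :|: X | adj E x u]| <= 2.
  move=> /andP[cU mU] /andP[cU' mU'] mX cX.
  apply: sparse_inner_degree E_sparse _ _ => //.
    apply: leq_trans mM; apply: leq_trans (leq_card_setU _ _) _.
    by move: (leq_of_leqif (leq_card_setU U U')) mU mU' mX; clear; lia.
  have mono (A B : {set V}) y : A \subset B ->
      1 < #|[set u in A | adj E y u]| -> 1 < #|[set u in B | adj E y u]|.
    move=> /subsetP AB /leq_trans; apply; apply/subset_leq_card/subsetP => u.
    by rewrite !inE => /andP[/AB -> ->].
  move=> y; rewrite !inE -orbA => /or3P[yU | yU' | /cX //].
    by apply: (mono U); [rewrite -setUA subsetUl | exact: (forall_inP cU)].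
  apply: (mono U'); last exact: (forall_inP cU').
  by rewrite setUAC subsetUr.
(* Besides two neighbours in its core [U], [v] has a third one outside [U]; were that in another
   core [U'], the union would give [v] inner degree three. *)
have exit v : v \in Z -> exists2 u, adj E v u & u \notin Z.
  case/bigcupP => U cU vU.
  have /existsP[w /andP[vw wU]] : [exists w, adj E v w && (w \notin U)].
    rewrite -negb_forall_in; apply/negP => /forall_inP sub.
    suff : #|[set u in U | adj E v u]| <= 2.
      apply/negP; rewrite -ltnNge; apply: leq_trans (deg3 v) _.
      by apply/subset_leq_card/subsetP => u; rewrite !inE => vu; rewrite vu sub.
    have := @coreU U U set0 v cU cU; rewrite cards0 setU0 setUid vU.
    by apply=> // y; rewrite inE.
  exists w => //; apply/bigcupP => -[U' cU' wU'].
  have [/andP[cU2 _]] := cU.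
  have := forall_inP cU2 v vU => /card_gt1P[a [b [aU bU ab]]].
  move: aU bU; rewrite !inE => /andP[aU va] /andP[bU vb].
  have : #|[set u in U :|: U' | adj E v u]| <= 2.
    have := @coreU U U' set0 v cU cU'; rewrite cards0 setU0 [v \in _]inE vU.
    by apply=> // y; rewrite inE.
  apply/negP; rewrite -ltnNge.
  apply: (@card_gt2_mem _ _ a b w); rewrite ?inE ?aU ?bU ?wU' ?va ?vb ?vw ?orbT //.
    by apply: contraNneq wU => <-.
  by apply: contraNneq wU => <-.
pose out v := [pick u | adj E v u && (u \notin Z)].
pose I0 := [set u | [exists v in Z, out v == Some u]].
have outP v u : out v = Some u -> adj E v u /\ u \notin Z.
  by rewrite /out; case: pickP => // y /andP[vy yZ] [<-].
have I0_stable : stable E I0.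
  apply/stableP => u u'; rewrite !inE => /exists_inP[v vZ /eqP ov].
  move=> /exists_inP[v' v'Z /eqP ov']; apply/negP => uu'.
  have [vu uZ] := outP _ _ ov; have [v'u' u'Z] := outP _ _ ov'.
  have vv' : v != v'.
    by apply: contraTneq uu' => vE; move: ov'; rewrite -vE ov => -[->]; rewrite adj_irr.
  have [U cU vU] := bigcupP vZ; have [U' cU' v'U'] := bigcupP v'Z.
  have notU y : y \notin Z -> (y \notin U) && (y \notin U').
    move=> yZ; apply/andP; split; apply: contra yZ => yU; apply/bigcupP.
      by exists U.
    by exists U'.
  have /andP[uU uU'] := notU _ uZ; have /andP[u'U u'U'] := notU _ u'Z.
  have [/andP[cU2 _]] := cU.
  have := forall_inP cU2 v vU => /card_gt1P[a [b [aU bU ab]]].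
  move: aU bU; rewrite !inE => /andP[aU va] /andP[bU vb].
  (* If [u] and [u'] were adjacent, each would have two neighbours in the enlarged set, yet [v]
     would have three: [a], [b] and [u]. *)
  have : #|[set x in U :|: U' :|: [set u; u'] | adj E v x]| <= 2.
    apply: coreU => //; first by rewrite cards2; case: (u != u').
      2: by rewrite !inE vU.
    move=> y; rewrite !inE => /orP[]/eqP ->; apply/card_gt1P.
      exists v, u'; rewrite !inE vU eqxx uu' !orbT adj_sym vu; split=> //.
      by apply: contraNneq u'U => <-.
    exists v', u; rewrite !inE v'U' eqxx !orbT (adj_sym u' v') v'u' (adj_sym u' u) uu'.
    by split=> //; apply: contraNneq uU' => <-.
  apply/negP; rewrite -ltnNge.
  apply: (@card_gt2_mem _ _ a b u); rewrite ?inE ?aU ?bU ?eqxx ?va ?vb ?vu ?orbT //.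
    by apply: contraNneq uU => <-.
  by apply: contraNneq uU => <-.
have [I /maxsetP[I_stable I_max] /subsetP I0_sub] := maxset_exists I0_stable.
exists I; split=> //.
- move=> q qI; apply/exists_inP; apply: contraNT qI; rewrite negb_exists_in.
  move=> /forall_inP q_free; suff <- : q |: I = I by rewrite setU11.
  apply: I_max; last exact: subsetUr.
  apply/stableP => x y; rewrite !inE => /predU1P[->|xI] /predU1P[->|yI].
  + by rewrite adj_irr.
  + exact: q_free.
  + by rewrite adj_sym q_free.
  + exact: (stableP _ I_stable).
- move=> U cU mU; apply/pred0P => v /=; apply/negP => /andP[vU vI].
  have vZ : v \in Z by apply/bigcupP; exists U; rewrite // /core cU.
  case ov: (out v) => [u|]; last first.
    have [u vu uZ] := exit v vZ.
    by move: ov; rewrite /out; case: pickP => // /(_ u); rewrite vu uZ.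
  have [vu _] := outP _ _ ov.
  have uI : u \in I.
    by apply: I0_sub; rewrite inE; apply/exists_inP; exists v; rewrite ?ov.
  by have := stableP _ I_stable v u vI uI; rewrite vu.
Qed.

(** With [K = d ^ 4], a cut walk of length [8 * K + 4] closes to a cycle on at most [m = 8 * K + 5]
    vertices, and [2 * m + 2] is the sparsity range. *)
Lemma normal_of_sparse d : simple_graph E ->
  (forall v, 3 <= degree E v <= d) -> sparse (16 * d ^ 4 + 12) ->
  normal_graph E.
Proof.
move=> E_simple deg E_sparse.
have [||I [I_stable I_dom I_core]] :=
  @stable_avoiding_cores _ (8 * d ^ 4 + 5) E_simple E_sparse.
- by move: (d ^ 4); clear; lia.
- by move=> v; case/andP: (deg v).
pose far := [rel x y | [exists q, exists s, exists r,
  [&& adj E x q, adj E q s, adj E s r & adj E r y]]].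
have far_sym : symmetric far.
  have sub x y : far x y -> far y x.
    move=> /= /existsP[q /existsP[s /existsP[r /and4P[xq qs sr ry]]]].
    apply/existsP; exists r; apply/existsP; exists s; apply/existsP; exists q.
    by rewrite adj_sym ry adj_sym sr adj_sym qs adj_sym xq.
  by move=> x y; apply/idP/idP; apply: sub.
pose step (A : {set V}) := \bigcup_(x in A) [set y | adj E x y].
have card_step A : #|step A| <= #|A| * d.
  apply: leq_trans (card_bigcup_leq _ _) _; rewrite -sum_nat_const.
  by apply: leq_sum => x _; case/andP: (deg x).
have far_deg x : #|[set y | far x y]| <= d ^ 4.
  apply: (@leq_trans #|step (step (step (step [set x])))|); last first.
    do 4![apply: leq_trans (card_step _) _; rewrite ?expnSr leq_mul2r; apply/orP; right].
    by rewrite cards1.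
  apply/subset_leq_card/subsetP => y; rewrite inE.
  move=> /existsP[q /existsP[s /existsP[r /and4P[xq qs sr ry]]]].
  by do ![apply/bigcupP; eexists; last by rewrite inE; eassumption]; rewrite inE.
have [col colP] := bounded_degree_coloring far_sym far_deg.
apply: (@normal_of_levels I (d ^ 4) (fun x => col x)) => //.
- move=> c _; have /andP[/ltnW/ltnW/card_gt0P[q]] := deg c.
  by rewrite inE; exists q.
- by move=> x; rewrite -ltnS.
- move=> c q s r c' cq qs sr rc' cc'; apply: contraTeq (eqxx (col c)) => ne_cc'.
  have -> : col c = col c' by exact: val_inj.
  rewrite -{1}(val_inj cc' : col c = col c'); apply: colP => //.
  by apply/existsP; exists q; apply/existsP; exists s; apply/existsP; exists r;
     rewrite cq qs sr.
- move=> q r p qI rI qr qp lq sp.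
  have [U [U_core mU [c cU cI]]] := crossing_odd_cycle qI rI qr qp lq.
  have := I_core U U_core; move/(_ (leq_trans mU _))/pred0P => /(_ _ c) /=.
  by rewrite cU cI => /(_ ltac:(by move: sp; move: (d ^ 4); clear; lia)).
Qed.

End Deterministic.

(** * Switchings and the number of regular graphs containing given edges *)

Lemma card_dep_pairs (T T' : finType) (A : {set T}) (B : T -> {set T'}) :
  #|[set p : T * T' | (p.1 \in A) && (p.2 \in B p.1)]| = \sum_(x in A) #|B x|.
Proof.
rewrite -sum1dep_card -(pair_big_dep (mem A) (fun x y => y \in B x) (fun _ _ => 1)).
by apply: eq_bigr => x _; rewrite sum1_card.
Qed.

Lemma bin_leq_expn n k : 'C(n, k) <= n ^ k.
Proof.
apply: (@leq_trans (n ^_ k)); first by rewrite -bin_ffact leq_pmulr // fact_gt0.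
elim: k n => [|k IHk] [|n] //.
rewrite ffactSS expnS leq_mul2l /=; apply: leq_trans (IHk n) _.
by case: k {IHk} => // k; rewrite leq_exp2r.
Qed.

Section Switching.

Variables (V : finType) (d : nat).
Implicit Types (E F : {set {set V}}) (e : {set V}).

Lemma degree_incidence E v : simple_graph E ->
  degree E v = \sum_(e in E) (v \in e).
Proof.
move=> E_simple; rewrite -big_mkcondr sum1dep_card /degree.
rewrite -(@card_in_imset _ _ (fun u => [set v; u])) => [|x y]; last first.
  rewrite !inE => /andP[vx _] /andP[vy _] /setP/(_ x).
  by rewrite !inE eqxx orbT eq_sym (negPf vx) => /esym/eqP.
apply: eq_card => e; rewrite inE; apply/imsetP/andP => [[u + ->]|[eE ve]].
  by rewrite !inE eqxx => /andP[_ ->].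
have /cards2P[a [b [ab e_ab]]] := forall_inP E_simple e eE.
move: ve; rewrite e_ab !inE => /orP[]/eqP->.
  by exists b; rewrite // inE /adj ab -e_ab.
by exists a; [rewrite inE adj_sym /adj ab -e_ab | exact: setUC].
Qed.

Definition switch E x y a b : {set {set V}} :=
  [set x; a] |: ([set y; b] |: (E :\ [set x; y] :\ [set a; b])).

Definition regular_containing F : {set {set {set V}}} :=
  [set E | [&& simple_graph E, regular d E & F \subset E]].

Definition closed_nbhd E y := y |: [set u | adj E y u].

(* For [a] outside this set and [b] adjacent to [a], the switch creates no
   multiple edge or loop and destroys no edge of [F]. *)
Definition switch_avoid E F x y : {set V} :=
  cover F :|: closed_nbhd E x :|: \bigcup_(u in closed_nbhd E y) closed_nbhd E u.

(** The terms bound the three pieces of [switch_avoid] when [F] has [k] edges. *)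
Definition switch_room k := 2 * k + d.+1 + d.+1 ^ 2.

Section Switch.

Variables (E F : {set {set V}}) (x y a b : V).
Hypothesis E_simple : simple_graph E.
Hypothesis xyE : adj E x y.
Hypothesis abE : adj E a b.
Hypothesis a_avoid : a \notin switch_avoid E F x y.

Let a_notin : [/\ a \notin cover F, a \notin closed_nbhd E x
                & b \notin closed_nbhd E y].
Proof.
move: a_avoid; rewrite /switch_avoid 2!in_setU 2!negb_or => /andP[/andP[-> ->] aN].
split=> //; apply: contra aN => bN; apply/bigcupP; exists b => //.
by rewrite !inE adj_sym abE orbT.
Qed.

Let distinct : [/\ x != y, a != b, a != x, a != y & (b != x) && (b != y)].
Proof.
have [_ + +] := a_notin; rewrite !inE !negb_or => /andP[ax nax] /andP[b_y nby].
split=> //; first by case/andP: xyE.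
- by case/andP: abE.
- by apply: contraNneq nax => ->.
- by rewrite b_y andbT; apply: contraNneq nby => ->; rewrite adj_sym.
Qed.

Let xaE : [set x; a] \notin E.
Proof.
have [_ + _] := a_notin; rewrite !inE !negb_or => /andP[ax].
by rewrite /adj eq_sym ax.
Qed.

Let ybE : [set y; b] \notin E.
Proof.
have [_ _] := a_notin; rewrite !inE !negb_or => /andP[b_y].
by rewrite /adj eq_sym b_y.
Qed.

Let xa_yb : [set x; a] != [set y; b].
Proof.
have [xy ab ax ay /andP[bx b_y]] := distinct.
by apply/eqP => /setP/(_ x); rewrite !inE eqxx (negPf xy) [x == b]eq_sym (negPf bx).
Qed.

Let ab_xy : [set a; b] != [set x; y].
Proof.
have [xy ab ax ay /andP[bx b_y]] := distinct.
by apply/eqP => /setP/(_ a); rewrite !inE eqxx (negPf ax) (negPf ay).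
Qed.

Let xyE' : [set x; y] \in E. Proof. by case/andP: xyE. Qed.
Let abE' : [set a; b] \in E. Proof. by case/andP: abE. Qed.

Lemma switch_simple : simple_graph (switch E x y a b).
Proof.
have [xy ab ax ay /andP[bx b_y]] := distinct.
apply/forall_inP => e; rewrite !inE => /or3P[/eqP->|/eqP->|/and3P[_ _ eE]].
- by rewrite cards2 [x == a]eq_sym ax.
- by rewrite cards2 [y == b]eq_sym b_y.
- exact: (forall_inP E_simple).
Qed.

(** The removed pair of edges and the added pair both cover each of the four distinct vertices
    once. *)
Lemma switch_degree v : degree (switch E x y a b) v = degree E v.
Proof.
have [xy ab ax ay /andP[bx b_y]] := distinct.
rewrite !degree_incidence //; last exact: switch_simple.
rewrite (big_setD1 _ xyE') (big_setD1 [set a; b]) /=; last first.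
  by rewrite !inE ab_xy.
rewrite big_setU1 ?big_setU1 ?inE ?(negPf ybE) ?(negPf xaE) ?(negPf xa_yb) ?andbF //=.
rewrite !addnA; congr (_ + _).
case: (eqVneq v x) => [->|vx]; rewrite ?eqxx ?(negPf xy) ?[x == a]eq_sym
  ?[x == b]eq_sym ?(negPf ax) ?(negPf bx) //.
case: (eqVneq v y) => [->|vy]; rewrite ?eqxx ?[y == a]eq_sym
  ?[y == b]eq_sym ?(negPf ay) ?(negPf b_y) //=.
by case: (eqVneq v a) => [->|va]; rewrite ?(negPf ab) //= addnC.
Qed.

Lemma switch_adj : adj (switch E x y a b) x a && adj (switch E x y a b) y b.
Proof.
have [xy ab ax ay /andP[bx b_y]] := distinct.
by rewrite /adj !inE !eqxx /= !(orbT, andbT) [x == a]eq_sym ax [y == b]eq_sym b_y.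
Qed.

Lemma switch_contains : [set x; y] \notin F -> F \subset E ->
  F \subset switch E x y a b.
Proof.
move=> xyF /subsetP FE; apply/subsetP => e eF; rewrite !inE (FE e eF) andbT.
rewrite !orbA; apply/orP; right; apply/andP; split; last first.
  by apply: contraNneq xyF => <-.
have [aF _ _] := a_notin; apply: contraNneq aF => e_ab.
by apply/bigcupP; exists e; rewrite // e_ab !inE eqxx.
Qed.

(** Recovers [E] from its switch, so switching is injective once [a] and [b] are recorded. *)
Lemma mem_unswitch e : (e \in E) =
  [|| e == [set x; y], e == [set a; b] |
    [&& e != [set x; a], e != [set y; b] & e \in switch E x y a b]].
Proof.
case: (eqVneq e [set x; y]) => [->|exy] /=; first by rewrite xyE'.
case: (eqVneq e [set a; b]) => [->|eab] /=; first by rewrite abE'.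
case: (eqVneq e [set x; a]) => [->|exa] /=; first by rewrite (negPf xaE).
case: (eqVneq e [set y; b]) => [->|eyb] /=; first by rewrite (negPf ybE).
by rewrite !inE (negPf exy) (negPf eab) (negPf exa) (negPf eyb).
Qed.

End Switch.

Lemma card_switch_avoid E F x y : simple_graph F -> regular d E ->
  #|switch_avoid E F x y| <= switch_room #|F|.
Proof.
move=> F_simple E_reg.
have card_nbhd u : #|closed_nbhd E u| <= d.+1.
  apply: leq_trans (leq_card_setU _ _) _; rewrite cards1 add1n ltnS.
  by rewrite -(eqP (forallP E_reg u)).
apply: leq_trans (leq_card_setU _ _) _; apply: leq_add.
  apply: leq_trans (leq_card_setU _ _) (leq_add _ (card_nbhd x)).
  apply: leq_trans (leq_card_cover F) _; rewrite mulnC -sum_nat_const.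
  by apply: leq_sum => e eF; rewrite (eqP (forall_inP F_simple e eF)).
apply: (@leq_trans (\sum_(u in closed_nbhd E y) d.+1)); last first.
  by rewrite sum_nat_const expnS expn1 leq_mul2r card_nbhd orbT.
apply: leq_trans (card_bigcup_leq _ _) _.
by apply: leq_sum => u _; exact: card_nbhd.
Qed.

(** Each graph containing [e] has at least [d * (#|V| - switch_room #|F|)] admissible pairs
    [(a, b)]. A switched graph, recorded with its pair, has [a] next to [x] and [b] next to [y]:
    [d * d] options. One factor [d] cancels. *)
Lemma switching_bound F e : 0 < d -> simple_graph F -> e \notin F ->
  #|regular_containing (e |: F)| * (#|V| - switch_room #|F|) <=
    d * #|regular_containing F|.
Proof.
move=> d_gt0 F_simple eF.
have [e2|e2] := boolP (#|e| == 2); last first.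
  suff -> : regular_containing (e |: F) = set0 by rewrite cards0.
  apply/setP => E; rewrite !inE subUset sub1set; apply/negP.
  by move=> /and4P[/forall_inP E_simple _ /E_simple]; rewrite (negPf e2).
have /cards2P[x [y [xy e_xy]]] := e2.
pose PX E := [set q : V * V |
  (q.1 \in ~: switch_avoid E F x y) && (q.2 \in [set u | adj E q.1 u])].
pose PY E := [set q : V * V |
  (q.1 \in [set u | adj E x u]) && (q.2 \in [set u | adj E y u])].
pose X := [set p : {set {set V}} * (V * V) |
  (p.1 \in regular_containing (e |: F)) && (p.2 \in PX p.1)].
pose Y := [set p : {set {set V}} * (V * V) |
  (p.1 \in regular_containing F) && (p.2 \in PY p.1)].
pose f (p : {set {set V}} * (V * V)) := (switch p.1 x y p.2.1 p.2.2, p.2).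
have XP E a b : (E, (a, b)) \in X -> [/\ simple_graph E, regular d E,
    F \subset E, adj E x y & adj E a b /\ a \notin switch_avoid E F x y].
  rewrite !inE /= subUset sub1set => /andP[/and4P[ES ER eE FE] /andP[av ab]].
  by split=> //; rewrite /adj xy -e_xy.
have fXY : f @: X \subset Y.
  apply/subsetP => _ /imsetP[[E [a b]] /XP[ES ER FE xyE [abE av]] ->].
  have /andP[xa yb] := switch_adj xyE abE av.
  rewrite !inE /= xa yb (switch_simple ES xyE abE av) !andbT /=.
  apply/andP; split; last by rewrite (switch_contains abE av) -?e_xy.
  by apply/forallP => v; rewrite (switch_degree ES xyE abE av) (forallP ER).
have f_inj : {in X &, injective f}.
  move=> [E [a b]] [E' [a' b']] /XP[ES ER FE xyE [abE av]].
  move=> /XP[ES' ER' FE' xyE' [abE' av']] [fE aa' bb'].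
  rewrite -aa' -bb' in abE' av' fE *; congr (_, _); apply/setP => e'.
  by rewrite (mem_unswitch xyE abE av) (mem_unswitch xyE' abE' av') fE.
have card_X : #|regular_containing (e |: F)| * (d * (#|V| - switch_room #|F|)) <= #|X|.
  rewrite /X (card_dep_pairs _ PX) -sum_nat_const; apply: leq_sum => E.
  rewrite inE => /and3P[ES ER _].
  rewrite /PX (card_dep_pairs _ (fun a => [set u | adj E a u])) mulnC.
  apply: (@leq_trans (\sum_(a in ~: switch_avoid E F x y) d)); last first.
    by apply: leq_sum => a _; rewrite -(eqP (forallP ER a)).
  rewrite sum_nat_const leq_mul2r; apply/orP; right.
  by rewrite [#|~: _|]cardsCs setCK leq_sub2l // card_switch_avoid.
have card_Y : #|Y| = #|regular_containing F| * (d * d).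
  rewrite /Y (card_dep_pairs _ PY) -sum_nat_const; apply: eq_bigr => E.
  rewrite inE => /and3P[ES ER _].
  rewrite /PY (card_dep_pairs _ (fun=> [set u | adj E y u])) sum_nat_const.
  by rewrite -[#|_|]/(degree E x) -[#|_|]/(degree E y) !(eqP (forallP ER _)).
have := leq_trans card_X (leq_trans _ (subset_leq_card fXY)).
rewrite card_in_imset // card_Y => /(_ (leqnn _)).
by rewrite mulnCA [X in _ <= X]mulnC -mulnA leq_pmul2l.
Qed.

(** Delete the edges of [F] one by one; each costs a factor [2 * d / #|V|]. *)
Lemma card_regular_containing k F : 0 < d -> 2 * switch_room k <= #|V| ->
  #|F| <= k ->
  #|regular_containing F| * #|V| ^ #|F| <=
    (2 * d) ^ #|F| * #|regular_containing set0|.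
Proof.
move=> d_gt0 V_large; move cF : #|F| => c.
elim: c F cF => [|c IHc] F cF ck.
  by rewrite (cards0_eq cF) expn0 muln1 mul1n.
have [F_simple|] := boolP (simple_graph F); last first.
  rewrite negb_forall_in => /exists_inP[e eF e2].
  suff -> : regular_containing F = set0 by rewrite cards0.
  apply/setP => E; rewrite !inE; apply/negP => /and3P[/forall_inP ES _ /subsetP FE].
  by rewrite ES ?FE in e2.
have /card_gt0P[e eF] : 0 < #|F| by rewrite cF.
have cF' : #|F :\ e| = c by move: cF; rewrite (cardsD1 e) eF => -[].
have F'_simple : simple_graph (F :\ e).
  by apply/forall_inP => e'; rewrite !inE => /andP[_]; apply: (forall_inP F_simple).
have := switching_bound d_gt0 F'_simple (negbT (setD11 e F)); rewrite setD1K // cF'.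
have := IHc _ cF' (ltnW ck).
have room : switch_room c <= switch_room k.
  by rewrite /switch_room !leq_add2r leq_mul2l ltnW.
move: room V_large; rewrite !expnS; move: (switch_room c) (switch_room k).
move: #|regular_containing F| #|V| ((2 * d) ^ c) (#|V| ^ c).
move: #|regular_containing (F :\ e)| #|regular_containing set0|.
clear=> g' g gF n dc nc s t st tn IH sw.
(* As [s <= t] and [2 * t <= n], at least half of [n] survives the subtraction. *)
have {}sw : gF * n <= 2 * d * g'.
  rewrite -mulnA; apply: leq_trans (leq_mul (leqnn 2) sw).
  by rewrite mulnCA leq_mul2l; apply/orP; right; move: st tn; clear; lia.
apply: (@leq_trans (2 * d * g' * nc)).
  by rewrite mulnA leq_mul2r sw orbT.
by rewrite -!mulnA leq_mul2l leq_mul2l; apply/orP; right; apply/orP; right.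
Qed.

End Switching.

(** * Union bound over small dense vertex sets *)

Section UnionBound.

Variables (V : finType) (d M : nat).
Hypothesis d_gt0 : 0 < d.
Hypothesis V_large : 2 * switch_room d M.+1 <= #|V|.

Let n := #|V|.
Let g := #|@regular_containing V d set0|.
(** The first factor bounds the number of families of subsets of [W], the second comes from
    [card_regular_containing]. *)
Let C0 := 2 ^ 2 ^ M * (2 * d) ^ M.+1.

Let dense_families (W : {set V}) :=
  [set F : {set {set V}} | F \subset powerset W & #|F| == #|W|.+1].

Let n_gt0 : 0 < n.
Proof. by apply: leq_trans V_large; rewrite muln_gt0 /switch_room addn_gt0 addnS. Qed.

Let card_dense_on (W : {set V}) : #|W| <= M ->
  (\sum_(F in dense_families W) #|regular_containing d F|) * n ^ #|W|.+1
    <= C0 * g.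
Proof.
move=> WM; rewrite big_distrl /=.
apply: (@leq_trans (\sum_(F in dense_families W) (2 * d) ^ M.+1 * g)).
  apply: leq_sum => F; rewrite inE => /andP[_ /eqP cF]; rewrite -cF.
  have FM : #|F| <= M.+1 by rewrite cF ltnS.
  apply: leq_trans (card_regular_containing d_gt0 V_large FM) _.
  by rewrite leq_mul2r leq_pexp2l ?orbT // muln_gt0.
rewrite sum_nat_const mulnA leq_mul2r; apply/orP; right.
rewrite leq_mul2r; apply/orP; right.
apply: (@leq_trans #|powerset (powerset W)|).
  by apply/subset_leq_card/subsetP => F; rewrite !inE => /andP[].
by rewrite !card_powerset !leq_pexp2l ?expn_gt0.
Qed.

(** At most [n ^ k] sets have size [k], and each is dense in at most a fraction [C0 / n ^ k.+1] of
    the graphs; each of the [M.+1] sizes thus contributes [C0 / n]. *)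
Lemma card_not_sparse :
  #|[set E in @regular_containing V d set0 | ~~ sparse E M]| * #|V| <=
    M.+1 * (2 ^ 2 ^ M * (2 * d) ^ M.+1) * #|@regular_containing V d set0|.
Proof.
rewrite -/n -/g -/C0.
have cover_bad : [set E in @regular_containing V d set0 | ~~ sparse E M] \subset
    \bigcup_(W : {set V} | #|W| <= M)
      \bigcup_(F in dense_families W) regular_containing d F.
  apply/subsetP => E; rewrite inE => /andP[/[!inE] /and3P[ES ER _]].
  rewrite negb_forall => /existsP[W]; rewrite negb_imply -ltnNge => /andP[WM].
  case/card_geqP => s [s_uniq s_size sE].
  apply/bigcupP; exists W => //; apply/bigcupP; exists [set e in s].
    rewrite inE cardsE (card_uniqP s_uniq) s_size eqxx andbT.
    by apply/subsetP => e; rewrite !inE => /sE; rewrite inE => /andP[].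
  rewrite inE ES ER /=; apply/subsetP => e; rewrite inE => /sE.
  by rewrite inE => /andP[].
apply: leq_trans (leq_mul (leq_trans (subset_leq_card cover_bad) _) (leqnn n)) _.
  apply: leq_trans (card_bigcup_leq _ _) (leq_sum _ (fun W _ => card_bigcup_leq _ _)).
rewrite big_distrl /=.
(* Sort the sets by size; [inord] is faithful because [#|W| <= M]. *)
rewrite (partition_big (fun W : {set V} => inord #|W| : 'I_M.+1) xpredT) //=.
rewrite -mulnA -[X in _ <= X * _](card_ord M.+1) -sum_nat_const.
apply: leq_sum => k _; rewrite -(@leq_pmul2l (n ^ k)) ?expn_gt0 ?n_gt0 //.
rewrite big_distrr /=.
apply: (@leq_trans (\sum_(W : {set V} | #|W| == k) C0 * g)).
  rewrite big_mkcond [X in _ <= X]big_mkcond; apply: leq_sum => W _.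
  case: ifP => // /andP[WM /eqP kW].
  have {kW} kW : k = #|W| :> nat by rewrite -kW inordK.
  rewrite kW eqxx mulnCA -expnSr; exact: card_dense_on.
rewrite sum_nat_const leq_mul2r; apply/orP; right.
by rewrite -cardsE card_draws bin_leq_expn.
Qed.

End UnionBound.

(** * Existence of regular graphs, via circulants *)

Section Circulant.

Import GRing.Theory.
Local Open Scope ring_scope.

Variables (m d : nat).
Hypothesis d_small : (d <= m)%N.
Hypothesis dn_even : ~~ odd (d * m.+1).

Let h := d./2.
Let S1 : {set 'I_m.+1} := [set x : 'I_m.+1 | 0 < x <= h]%N.
(** The element of order two when [m.+1] is even, which [dn_even] ensures for odd [d]. *)
Let mid : 'I_m.+1 := inord m.+1./2.
Let S0 := S1 :|: [set - x | x in S1].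
Let S := if odd d then mid |: S0 else S0.

Let val_opp (x : 'I_m.+1) : (0 < x)%N -> - x = (m.+1 - x)%N :> nat.
Proof. by move=> x0; rewrite /= modn_small //; lia. Qed.

Let card_S1 : #|S1| = h.
Proof.
have h_m : (h <= m)%N by rewrite /h; lia.
rewrite -[RHS]card_ord -(@card_imset _ _ (fun i : 'I_h => inord i.+1 : 'I_m.+1)).
  apply: eq_card => x; rewrite inE; apply/idP/imsetP => [/andP[x0 xh]|[i _ ->]].
    have xh' : (x.-1 < h)%N by lia.
    by exists (Ordinal xh'); rewrite //= prednK // inord_val.
  by rewrite inordK // ltnS (leq_trans (ltn_ord i)).
move=> i j /(congr1 (@nat_of_ord _)); rewrite !inordK ?ltnS ?(leq_trans (ltn_ord _)) //.
by case=> /val_inj.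
Qed.

Let S0_opp x : (- x \in S0) = (x \in S0).
Proof.
have sub y : y \in S0 -> - y \in S0.
  rewrite !inE => /orP[yS|/imsetP[z zS ->]].
    by apply/orP; right; apply: imset_f; rewrite inE.
  by rewrite opprK; move: zS; rewrite inE => ->.
by apply/idP/idP => /sub; rewrite ?opprK.
Qed.

Let S1_lt x : x \in S0 -> (0 < x)%N && ((x <= h) || (m.+1 - x <= h))%N.
Proof.
rewrite !inE => /orP[/andP[-> ->]//|/imsetP[y]].
rewrite inE => /andP[y0 yh] ->; rewrite val_opp //.
by have := ltn_ord y; move: y0 yh; clear; lia.
Qed.

(** [S1] and its negatives are disjoint because [2 * h <= d <= m]. *)
Let card_S0 : #|S0| = h.*2.
Proof.
rewrite cardsU card_imset; last exact: oppr_inj.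
rewrite card_S1 [#|_ :&: _|]eq_card0 ?subn0 ?addnn // => x.
apply/negP; rewrite !inE => /andP[/andP[x0 xh] /imsetP[y]].
rewrite inE => /andP[y0 yh] xy; move: xh; rewrite xy val_opp //.
have := ltn_ord y; move: yh d_small; rewrite /h; clear; lia.
Qed.

Let midE : odd d -> mid = m.+1./2 :> nat /\ (m.+1./2).*2 = m.+1.
Proof.
move=> d_odd; have := dn_even; rewrite oddM d_odd /= negbK => m_odd.
split; first by rewrite inordK //; lia.
by rewrite -[RHS]odd_double_half /= m_odd.
Qed.

Let S_opp x : (- x \in S) = (x \in S).
Proof.
rewrite /S; case: ifP => // d_odd; have [mid_val half] := midE d_odd.
rewrite !in_setU1 S0_opp; congr (_ || _).
suff mid_opp : - mid = mid by rewrite -{1}mid_opp (inj_eq oppr_inj).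
by apply: ord_inj; rewrite val_opp mid_val; lia.
Qed.

Let S_zero : 0 \notin S.
Proof.
have S0_zero : 0 \notin S0 by apply/negP => /S1_lt.
rewrite /S; case: ifP => // d_odd; rewrite in_setU1 negb_or S0_zero andbT.
have [mid_val half] := midE d_odd.
by apply/eqP => /(congr1 (@nat_of_ord _)); rewrite mid_val /=; lia.
Qed.

Let card_S : #|S| = d.
Proof.
rewrite /S; case: ifP => d_odd; last by rewrite card_S0 /h; lia.
have [mid_val half] := midE d_odd.
rewrite cardsU1 card_S0 (_ : mid \notin S0) ?/h; first lia.
by apply/negP => /S1_lt; rewrite mid_val /h; lia.
Qed.

Let circulant : {set {set 'I_m.+1}} :=
  [set e | [exists i, exists s, (s \in S) && (e == [set i; i + s])]].

Let circulant_adj i j : adj circulant i j = (j - i \in S).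
Proof.
rewrite /adj inE; apply/andP/idP => [[ij /existsP[k /existsP[s /andP[sS]]]]|ijS].
  move=> /eqP e_ij.
  have : i \in [set k; k + s] by rewrite -e_ij !inE eqxx.
  have : j \in [set k; k + s] by rewrite -e_ij !inE eqxx orbT.
  rewrite !inE => /orP[]/eqP jE /orP[]/eqP iE; move: ij.
  - by rewrite jE iE eqxx.
  - by rewrite jE iE opprD addrA subrr sub0r S_opp.
  - by move=> _; rewrite jE iE addrC addKr.
  - by rewrite jE iE eqxx.
split.
  by apply: contraNneq S_zero => ij; rewrite ij subrr in ijS.
by apply/existsP; exists i; apply/existsP; exists (j - i); rewrite ijS addrC subrK eqxx.
Qed.

(** Needed since [uniform_prob] is [0] on an empty space. The neighbours of [i] form a translate of
    [S]. *)
Lemma circulant_regular : exists E, E \in regular_graphs m.+1 d.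
Proof.
exists circulant; rewrite inE; apply/andP; split.
  apply/forall_inP => e; rewrite inE => /existsP[i /existsP[s /andP[sS /eqP->]]].
  rewrite cards2; suff -> : i != i + s by [].
  by apply: contraNneq S_zero => i_s; rewrite -(addNr i) {2}i_s addKr.
apply/forallP => i; rewrite -card_S /degree; apply/eqP.
rewrite -[RHS](card_imset _ (addIr i)); apply: eq_card => j.
rewrite inE circulant_adj; apply/idP/imsetP => [jS|[x xS ->]].
  by exists (j - i); rewrite ?subrK.
by rewrite addrK.
Qed.

End Circulant.

(** * Failure probability of order [1 / n], and the limit *)

Lemma few_non_normal d : 2 < d -> exists C N, forall n, N <= n ->
  ~~ odd (d * n) -> 0 < #|regular_graphs n d| /\
  #|[set E in regular_graphs n d | ~~ normal_graph E]| * n <=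
    C * #|regular_graphs n d|.
Proof.
move=> d3; pose M := 16 * d ^ 4 + 12.
exists (M.+1 * (2 ^ 2 ^ M * (2 * d) ^ M.+1)).
(* The first bound serves the circulant, the second the switchings. *)
exists (maxn d.+1 (2 * switch_room d M.+1)) => n.
rewrite geq_max => /andP[dn nM] dn_even; split.
  case: n dn nM dn_even => // m dm _ dn_even; apply/card_gt0P.
  by apply: circulant_regular.
have regE : regular_graphs n d = @regular_containing 'I_n d set0.
  by apply/setP => E; rewrite !inE sub0set andbT.
have := @card_not_sparse 'I_n d M (ltnW (ltnW d3)); rewrite card_ord => /(_ nM).
rewrite regE; apply: leq_trans; rewrite leq_mul2r; apply/orP; right.
apply/subset_leq_card/subsetP => E; rewrite !inE.
move=> /andP[/and3P[E_simple E_reg E0] E_normal].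
rewrite E_simple E_reg E0; apply: contra E_normal => E_sparse.
apply: (normal_of_sparse E_simple _ E_sparse) => v.
by rewrite (eqP (forallP E_reg v)) d3 leqnn.
Qed.

Lemma onem_uniform_prob (R : numFieldType) (T : finType) (A : {set T})
    (P : pred T) : 0 < #|A| ->
  (1 - uniform_prob R A P = #|[set x in A | ~~ P x]|%:R / #|A|%:R)%R.
Proof.
move=> A_gt0; have A_neq0 : (#|A|%:R != 0 :> R)%R.
  by rewrite Num.Theory.pnatr_eq0 -lt0n.
rewrite /uniform_prob -{1}(GRing.divff A_neq0) -GRing.mulrBl; congr (_ / _)%R.
have -> : #|A| = #|[set x in A | P x]| + #|[set x in A | ~~ P x]|.
  rewrite -(cardsID [set x | P x] A); congr (_ + _); apply: eq_card => x.
    by rewrite !inE.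
  by rewrite !inE andbC.
by rewrite GRing.natrD GRing.addrAC GRing.subrr GRing.add0r.
Qed.

Unset Implicit Arguments.

From mathcomp Require Import all_classical all_reals all_analysis.
Import Order.TTheory GRing.Theory Num.Theory.
Import numFieldNormedType.Exports.
Local Open Scope classical_set_scope.
Local Open Scope ring_scope.

Theorem theorem3 (R : realType) (d : nat) (hd : (3 <= d)%N) :
  prob_normal R d n @[n --> within [set n : nat | ~~ odd (d * n)] \oo] --> (1 : R).
Proof.
have [C [N bound]] := few_non_normal hd.
apply/cvgrPdist_le => e e_gt0.
have Ce_ge0 : 0 <= C%:R / e by rewrite divr_ge0 // ltW.
(* Beyond [C / e] the failure bound [C / n] is at most [e]. *)
exists (maxn N (Num.bound (C%:R / e)).+1) => // n /=.
rewrite geq_max => /andP[Nn Cn] /(bound n Nn)[reg_gt0 few].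
have n_gt0 : (0 < n)%N by apply: leq_trans Cn.
have g_gt0 : 0 < #|regular_graphs n d|%:R :> R by rewrite ltr0n.
rewrite onem_uniform_prob // ger0_norm ?divr_ge0 // ler_pdivrMr //.
rewrite -(ler_pM2r (_ : 0 < n%:R)) ?ltr0n // -natrM.
apply: (@le_trans _ _ (C * #|regular_graphs n d|)%:R); first by rewrite ler_nat.
rewrite natrM mulrAC ler_wpM2r // mulrC -ler_pdivrMr //.
by rewrite (le_trans (ltW (archi_boundP Ce_ge0))) // ler_nat ltnW.
Qed.
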